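(* Let $w(y)=\left(1+\sqrt{1-y}\right)^{-1/2}$ for $0<y<1$. The variance function of the power series distribution of $w$ is $$v(x)=x(2x+1)(4x+1),\qquad x>0.$$
   Context: If $w(y)=\sum_{k\ge 0}a_k y^k$ for $0<y<R$ with all $a_k\ge 0$, the power series distribution of $w$ with parameter $y$ is the distribution of the nonnegative-integer-valued random variable $\xi$ with $\Pr(\xi=k)=a_k y^k/w(y)$, $k=0,1,2,\ldots$. Its mean is $E\xi=y w'(y)/w(y)$. Writing $x=E\xi$, the map $y\mapsto x$ is strictly increasing on $(0,R)$ and has an inverse $y=y(x)$. The variance of $\xi$ expressed as a function of the mean $x$ is $v(x)=y(x)/y'(x)$; this function is called the variance function of the distribution. For the given $w$ one has $R=1$ and the power series coefficients of $w$ are positive. *)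

(* Defs.v *)
From mathcomp Require Import all_boot all_order all_algebra.
From mathcomp Require Import all_classical all_reals all_analysis.

Set Implicit Arguments.
Unset Strict Implicit.
Unset Printing Implicit Defensive.

Import Order.TTheory GRing.Theory Num.Theory.
Import numFieldNormedType.Exports.

Local Open Scope classical_set_scope.
Local Open Scope ring_scope.

(* w y = \sum_k a k * y ^+ k on ]0, rho[, with nonnegative coefficients *)
Definition nonneg_expansion (R : realType) (w : R -> R) (rho : R)
    (a : nat -> R) : Prop :=
  (forall k, 0 <= a k) /\
  (forall y, 0 < y < rho -> pseries a y @ \oo --> w y).

(* The law on nat of a variable xi with Pr(xi = k) = a k * y ^+ k / w y.
   Every subset of nat is measurable, so at most one P satisfies this. *)
Definition is_psd (R : realType) (w : R -> R) (a : nat -> R) (y : R)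
    (P : probability nat R) : Prop :=
  forall k : nat, P [set k] = (a k * y ^+ k / w y)%:E.

(* Mean and variance of a law on nat are those of this variable. *)
Definition nat_value (R : realType) : nat -> R := fun k => k%:R.

(* y is the inverse of the mean map of the power series distributions of w:
   it sends the set D of all means onto ]0, rho[, increasingly, and the
   distribution with parameter y x exists and has mean x. *)
Definition is_inverse_mean (R : realType) (w : R -> R) (rho : R)
    (a : nat -> R) (D : set R) (y : R -> R) : Prop :=
  [/\ set_bij D [set t | 0 < t < rho] y,
      (forall s t, D s -> D t -> s < t -> y s < y t) &
      forall x, D x -> exists2 P : probability nat R,
        is_psd w a (y x) P & ('E_P[@nat_value R] = x%:E)%E].

(* v is the variance expressed as a function of the mean, the means ranging
   over D; it is also required to be given by the formula y x / y' x. *)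
Definition is_variance_function (R : realType) (w : R -> R) (rho : R)
    (a : nat -> R) (D : set R) (v : R -> R) : Prop :=
  exists2 y : R -> R, is_inverse_mean w rho a D y &
    forall x, D x ->
      [/\ (forall P : probability nat R, is_psd w a (y x) P ->
             ('V_P[@nat_value R] = (v x)%:E)%E),
          derivable y x 1,
          derive1 y x != 0 &
          v x = y x / derive1 y x].

Definition w_fun (R : realType) (y : R) : R :=
  (1 + Num.sqrt (1 - y)) `^ (- 2^-1).

(* Main.v *)
Require Import Defs.
From mathcomp Require Import all_boot all_order all_algebra.
From mathcomp Require Import all_classical all_reals all_analysis.
From mathcomp Require Import ring lra.

Set Implicit Arguments.
Unset Strict Implicit.
Unset Printing Implicit Defensive.

Import Order.TTheory GRing.Theory Num.Theory.
Import numFieldNormedType.Exports.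

Local Open Scope classical_set_scope.
Local Open Scope ring_scope.

(* Expansion: sqrt (1 + t) - sqrt (1 - t) = sqrt 2 * t * w (t ^ 2), so the
   coefficients of w are, up to a factor - sqrt 2, those of odd index in the
   binomial series of sqrt (1 - t), which are negative.
   Variance: with s = sqrt (1 - y), one has y * w' / w = (1 - s) / (4 * s); this
   is the mean m, and the variance is y * m' = y / (8 * s ^ 3). Since
   s = (1 + 4 * m)^-1, both are explicit in the mean. *)

(** * Termwise differentiation of power series *)

Section PowerSeries.
Context {R : realType}.
Implicit Types (c : nat -> R) (x z : R).

(** Comparison at a radius r strictly between |x| and |z|: the factor n + 1 is absorbed by (n + 1)
    |x| ^ n <= r ^ (n + 1) / (r - |x|), and the series of |c n| r ^ n converges since r < |z|. *)
Lemma is_cvg_pseries_diffs_inside c z x :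
  cvgn (pseries c z) -> `|x| < `|z| -> cvgn (pseries (pseries_diffs c) x).
Proof.
move=> cz xz; pose r := (`|x| + `|z|) / 2.
have xr : `|x| < r by rewrite /r; lra.
have rz : `|r| < `|z| by rewrite ger0_norm /r; have := normr_ge0 x; lra.
have r_gt0 : 0 < r := le_lt_trans (normr_ge0 x) xr.
have cr := is_cvg_pseries_inside_norm cz rz.
apply: normed_cvg.
apply: (@series_le_cvg _ _ (fun n => (r - `|x|)^-1 * (`|c n.+1| * r ^+ n.+1))).
- by move=> n; exact: normr_ge0.
- by move=> n; rewrite !mulr_ge0 ?invr_ge0 ?exprn_ge0 ?subr_ge0 // ltW.
- move=> n /=; rewrite /pseries_diffs !normrM normrX normr_nat.
  rewrite ler_pdivlMl ?subr_gt0 // mulrCA -!mulrA mulrCA ler_wpM2l //.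
  (* mean value bound: (r - |x|) (n+1) |x|^n <= r^(n+1) - |x|^(n+1) *)
  apply: (@le_trans _ _ (r ^+ n.+1 - `|x| ^+ n.+1)); last first.
    by rewrite gerBl exprn_ge0.
  rewrite subrXX mulrCA ler_wpM2l ?subr_ge0 ?(ltW xr) //.
  rewrite mulr_natl -[n.+1 in leLHS]card_ord -sumr_const ler_sum // => i _.
  have -> : `|x| ^+ n = `|x| ^+ (n.+1.-1 - i) * `|x| ^+ i.
    by rewrite -exprD subnK // -ltnS.
  by rewrite ler_wpM2r ?exprn_ge0 // lerXn2r ?nnegrE // ltW.
- apply: is_cvg_seriesZ.
  have -> : series (fun n => `|c n.+1| * r ^+ n.+1) =
      (fun n => pseries (fun i => `|c i|) r n.+1 - `|c 0|).
    apply/funext => n; rewrite /pseries /series /= big_nat_recl //=.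
    by rewrite expr0 mulr1 addrC addKr.
  apply: is_cvgB; last exact: is_cvg_cst.
  apply/cvg_ex; exists (limn (pseries (fun i => `|c i|) r)).
  by rewrite cvg_shiftS.
Unshelve. all: by []. Qed.

(** [pseries_snd_diffs] asks for convergence at r > |x| of the series and of its first two formal
    derivatives. Each differentiation costs some radius, hence two intermediate radii |x| < r < s <
    |z|. *)
Lemma is_derive_pseries c z x : cvgn (pseries c z) -> `|x| < `|z| ->
  is_derive x 1 (fun t => limn (pseries c t))
    (limn (pseries (pseries_diffs c) x)).
Proof.
move=> cz xz; pose r := (`|x| + `|z|) / 2.
have xr : `|x| < r by rewrite /r; lra.
have r_ge0 : 0 <= r by rewrite (le_trans (normr_ge0 x)) // ltW.
pose s := (r + `|z|) / 2.
have rz : r < `|z| by rewrite /r; lra.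
have s_ge0 : 0 <= s by rewrite /s; lra.
have rs : `|r| < `|s| by rewrite !ger0_norm // /s; lra.
have sz : `|s| < `|z| by rewrite ger0_norm // /s; lra.
apply: (@pseries_snd_diffs _ _ r); last by rewrite (ger0_norm r_ge0).
- by apply: is_cvg_pseries_inside cz _; exact: lt_trans sz.
- by apply: is_cvg_pseries_diffs_inside cz _; exact: lt_trans sz.
- apply: is_cvg_pseries_diffs_inside rs.
  exact: is_cvg_pseries_diffs_inside cz sz.
Qed.

(* The operator y * d/dy multiplies the k-th coefficient by k. *)
Lemma pseries_euler c (g : R -> R) (x d : R) :
  (forall y, 0 < y < 1 -> pseries c y @ \oo --> g y) -> 0 < x < 1 ->
  is_derive x 1 g d ->
  pseries (fun k => k%:R * c k) x @ \oo --> x * d.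
Proof.
move=> cg x01 gd; have /andP[x0 x1] := x01.
pose z := (x + 1) / 2.
have z01 : 0 < z < 1 by rewrite /z; lra.
have cz : cvgn (pseries c z) by apply/cvg_ex; exists (g z); exact: cg.
have xz : `|x| < `|z| by rewrite !gtr0_norm /z; lra.
have dc := is_derive_pseries cz xz.
(* Near x the function [g] is the sum of the series, so uniqueness of the derivative identifies [d]
   with the differentiated series. *)
have dE : limn (pseries (pseries_diffs c) x) = d.
  have dg : is_derive x 1 g (limn (pseries (pseries_diffs c) x)).
    apply: near_eq_is_derive dc; near=> t.
    apply/cvg_lim => //; apply: cg; apply/andP; split; near: t.
      exact: lt_nbhsr.
    exact: lt_nbhsl.
  by rewrite -(@derive_val _ _ _ _ _ _ _ dg) (@derive_val _ _ _ _ _ _ _ gd).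
have := pseries_diffs_equiv (is_cvg_pseries_diffs_inside cz xz).
rewrite dE => dl.
rewrite (_ : pseries _ _ =
    cst x \* series (fun k => k%:R * c k * x ^+ k.-1)).
  by apply: cvgM => //; exact: cvg_cst.
apply/funext => n /=.
(* At index 0 the truncated exponent [k.-1] is harmless: the factor k vanishes. *)
rewrite /pseries /series /= mulr_sumr; apply: eq_bigr => -[|k] _.
  by rewrite !mul0r mulr0.
by rewrite exprS mulrCA !mulrA.
Unshelve. all: by end_near. Qed.

End PowerSeries.

(** * Probability laws on the natural numbers given by point masses *)

Section LawsOnNat.
Context {R : realType}.
Implicit Types (p f : nat -> R) (l : R).

Lemma eseries_EFin f l : series f @ \oo --> l ->
  (\sum_(k <oo) (f k)%:E)%E = l%:E.
Proof.
move=> fl; apply/cvg_lim => //.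
rewrite (_ : (fun n => _) = EFin \o series f); last first.
  by apply/funext => n /=; rewrite sumEFin.
by apply: cvg_EFin => //; exact: nearW.
Qed.

(** The integral splits over the countable partition of [nat] into singletons, on each of which [f]
    is constant. *)
Lemma integral_law_nat (P : probability nat R) p f l :
  (forall k, P [set k] = (p k)%:E) -> (forall k, 0 <= f k) ->
  series (fun k => f k * p k) @ \oo --> l ->
  (\int[P]_k (f k)%:E = l%:E)%E.
Proof.
move=> Pp f0 fl; rewrite -(eseries_EFin fl).
have TE : [set: nat] = \bigcup_k [set k].
  by apply/seteqP; split => // k _; exists k.
rewrite TE ge0_integral_bigcup //; last 2 first.
- by move=> k _; rewrite lee_fin.
- by apply/trivIsetP => i j _ _ /eqP ij; apply/seteqP; split => // k [-> /ij].
apply: eq_eseriesr => k _.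
rewrite (eq_integral (cst (f k)%:E)); last by move=> n; rewrite inE => ->.
by rewrite integral_cst // EFinM -Pp.
Qed.

Lemma law_nat_exists p : (forall k, 0 <= p k) -> series p @ \oo --> (1 : R) ->
  exists P : probability nat R, forall k, P [set k] = (p k)%:E.
Proof.
move=> p0 p1.
pose m k : {measure set nat -> \bar R} :=
  mscale (NngNum (p0 k)) (@dirac _ nat k R).
pose mu : {measure set nat -> \bar R} := mseries m 0.
have muT : mu setT = 1%E.
  rewrite /mu /= /mseries -[RHS](eseries_EFin p1); apply: eq_eseriesr => k _.
  by rewrite /m /= /mscale /= diracT mule1.
(* Normalising packages the weighted sum of Dirac masses as a [probability]. Its mass is already 1,
   so the values do not change; the Dirac mass at 0 is the default for mass 0 or infinity. *)
exists (mnormalize mu (@dirac _ nat 0%N R)) => k.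
rewrite /= /mnormalize muT /= onee_eq0 /= invr1 mule1.
rewrite /mu /= /mseries (@nneseriesD1 _ _ k) //.
rewrite eseries0.
  by rewrite adde0 /m /= /mscale /= diracE mem_set //= mule1.
move=> i _ /= ik; rewrite /m /= /mscale /= diracE memNset ?mule0 //= => ki.
by rewrite ki eqxx in ik.
Qed.
End LawsOnNat.

(** * The binomial series of sqrt (1 - t) and the expansion of w *)

Lemma is_derive_sqrt1B {R : realType} (x : R) : x < 1 ->
  is_derive x 1 (fun t => Num.sqrt (1 - t)) (- (2 * Num.sqrt (1 - x))^-1).
Proof.
rewrite -subr_gt0 => x1; have ds := is_derive1_sqrt x1.
have db : is_derive x 1 (fun t : R => 1 - t) (- 1).
  by apply: is_derive_eq; rewrite add0r mul1r.
by have := is_derive1_comp (g := fun t : R => 1 - t) ds db; rewrite mulrN1.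
Qed.

Section SqrtSeries.
Context {R : realType}.
Implicit Types (t y : R).

(** These are the numbers (-1) ^ n binom(1/2, n). The recursive form gives the sign, the bound and
    the differential equation directly. *)
Fixpoint sqrt_coeff (n : nat) : R :=
  if n is m.+1 then (m%:R - 2^-1) / m.+1%:R * sqrt_coeff m else 1.

(** Only the first factor of the recursion, -1/2, is negative; all later ones are positive, so the
    sign persists. *)
Lemma sqrt_coeffS_lt0 n : sqrt_coeff n.+1 < 0.
Proof.
elim: n => [|n IH]; first by rewrite /= sub0r !mulr1 divr1; lra.
change (sqrt_coeff n.+2) with
  ((n.+1%:R - 2^-1) / n.+2%:R * sqrt_coeff n.+1).
rewrite pmulr_rlt0 // divr_gt0 // subr_gt0.
apply: (@lt_le_trans _ _ 1); [lra|by rewrite ler1n].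
Qed.

Lemma sqrt_coeff_le1 n : `|sqrt_coeff n| <= 1.
Proof.
elim: n => [|n IH] /=; first by rewrite normr1.
rewrite normrM mulr_ile1 // normrM normfV normr_nat ler_pdivrMr // mul1r.
by rewrite ler_norml -natr1; have := ler0n R n; lra.
Qed.

Lemma is_cvg_sqrt_series t : `|t| < 1 -> cvgn (pseries sqrt_coeff t).
Proof.
move=> t1; apply: normed_cvg.
apply: (@series_le_cvg _ _ (geometric 1 `|t|)).
- by move=> n; exact: normr_ge0.
- by move=> n; rewrite /geometric /= mul1r exprn_ge0.
- by move=> n; rewrite /geometric /= normrM normrX ler_wpM2r // sqrt_coeff_le1.
- by apply: is_cvg_geometric_series; rewrite normr_id.
Qed.

(** Multiplying the recursion (n + 1) c_(n+1) = (n - 1/2) c_n by t ^ n and summing gives f' = t f' -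
    f / 2 for the sum f. *)
Lemma sqrt_series_ode t : `|t| < 1 ->
  (1 - t) * limn (pseries (pseries_diffs sqrt_coeff) t) =
  - 2^-1 * limn (pseries sqrt_coeff t).
Proof.
move=> t1; pose z : R := (`|t| + 1) / 2.
have z0 : 0 <= z by rewrite /z; have := normr_ge0 t; lra.
have cz : cvgn (pseries sqrt_coeff z).
  by apply: is_cvg_sqrt_series; rewrite ger0_norm // /z; lra.
have tz : `|t| < `|z| by rewrite (ger0_norm z0) /z; lra.
have dc := is_cvg_pseries_diffs_inside cz tz.
have ec := pseries_diffs_equiv dc.
set d := limn _ in ec *.
set l := limn (pseries sqrt_coeff t).
have dE : pseries (pseries_diffs sqrt_coeff) t @ \oo --> t * d + - 2^-1 * l.
  rewrite (_ : pseries _ _ = (cst t \*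
      series (fun i => i%:R * sqrt_coeff i * t ^+ i.-1) \+
      cst (- 2^-1) \* pseries sqrt_coeff t)).
    by apply: cvgD; apply: cvgM => //;
      [exact: cvg_cst|exact: cvg_cst|exact: is_cvg_sqrt_series].
  apply/funext => n.
  rewrite /= /pseries /series /= !mulr_sumr -big_split /=.
  apply: eq_bigr => -[|k] _.
    by rewrite /pseries_diffs /=; field.
  rewrite /pseries_diffs.
  change (sqrt_coeff k.+2) with
    ((k.+1%:R - 2^-1) / k.+2%:R * sqrt_coeff k.+1).
  rewrite /= !exprS -!natr1; field.
  by have := ler0n R k; lra.
have {dE} : d = t * d + - 2^-1 * l by exact: cvg_lim dE.
by move: d {ec} => d; lra.
Qed.

(** By the differential equation, the quotient of the sum by sqrt (1 - t) has zero derivative on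
    ]-1, 1[; it is therefore constant, with value 1 at 0. *)
Lemma sqrt_seriesE t : `|t| < 1 ->
  limn (pseries sqrt_coeff t) = Num.sqrt (1 - t).
Proof.
pose f t := limn (pseries sqrt_coeff t).
have f0 : f 0 = 1.
  (* The shift skips the empty partial sum; at t = 0 all the others equal the coefficient of index
     0. *)
  apply/cvg_lim => //; rewrite -cvg_shiftS; apply: cvg_near_cst.
  apply: nearW => n; rewrite /pseries /series /= big_nat_recl // big1 ?addr0.
    by rewrite expr0 mulr1.
  by move=> i _; rewrite expr0n mulr0.
have df (x : R) : `|x| < 1 ->
    is_derive x 1 (fun t => f t * (Num.sqrt (1 - t))^-1) 0.
  move=> x1; pose z : R := (`|x| + 1) / 2.
  have z0 : 0 <= z by rewrite /z; have := normr_ge0 x; lra.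
  have cz : cvgn (pseries sqrt_coeff z).
    by apply: is_cvg_sqrt_series; rewrite ger0_norm // /z; lra.
  have xz : `|x| < `|z| by rewrite (ger0_norm z0) /z; lra.
  have dx := is_derive_pseries cz xz.
  have ode := sqrt_series_ode x1.
  have x1' : 0 < 1 - x by have := ler_norm x; lra.
  have s0 : Num.sqrt (1 - x) != 0 by rewrite gt_eqF // sqrtr_gt0.
  have xlt1 : x < 1 by rewrite -subr_gt0.
  have dsV := is_deriveV (f := fun t => Num.sqrt (1 - t)) s0
    (is_derive_sqrt1B xlt1).
  apply: is_derive_eq (is_deriveM dx dsV) _.
  rewrite /GRing.scale /=.
  move: ode s0 (sqr_sqrtr (ltW x1')).
  move: (limn (pseries sqrt_coeff x)) (limn _) (Num.sqrt _) => u v s ode s0 ss.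
  have {ode}-> : v = - 2^-1 * u / s ^+ 2.
    by rewrite -ode ss mulrAC divff ?mul1r // gt_eqF.
  by field.
pose h u := f u * (Num.sqrt (1 - u))^-1.
have hE a b : `|a| < 1 -> `|b| < 1 -> a <= b -> h a = h b.
  move=> a1 b1 ab; apply/esym/eqP; rewrite -subr_eq0; apply/eqP.
  have ab1 x : a <= x -> x <= b -> `|x| < 1.
    by move: a1 b1; rewrite !ltr_norml => /andP[a1 _] /andP[_ b1] *; lra.
  have [||_ _ ->] := @MVT_segment _ h (fun=> 0) a b ab; last by rewrite mul0r.
  - move=> x; rewrite in_itv /= => /andP[ax xb].
    by apply: df; apply: ab1; exact: ltW.
  - apply: derivable_within_continuous => x.
    rewrite in_itv /= => /andP[ax xb].
    by have [] := df x (ab1 x ax xb).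
move=> t1.
have h0 : h 0 = 1 by rewrite /h f0 subr0 sqrtr1 invr1 mulr1.
have ht : h t = 1.
  rewrite -h0; have [t0|t0] := leP t 0.
    by apply: hE => //; rewrite normr0.
  by apply/esym/hE; rewrite ?normr0 // ltW.
have s0 : Num.sqrt (1 - t) != 0.
  by rewrite gt_eqF // sqrtr_gt0; have := ler_norm t; lra.
by rewrite -/(f t) -[f t](divfK s0) -/(h t) ht mul1r.
Qed.

Lemma cvg_sqrt_series t : `|t| < 1 ->
  pseries sqrt_coeff t @ \oo --> Num.sqrt (1 - t).
Proof. by move=> t1; rewrite -sqrt_seriesE //; exact: is_cvg_sqrt_series. Qed.

(** Both sides are nonnegative, so it suffices to compare squares. With t = sqrt y and s = sqrt (1 -
    y) = sqrt (1 + t) sqrt (1 - t), these are 2 - 2 s and 2 t ^ 2 / (1 + s), equal because t ^ 2 =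
    (1 - s) (1 + s). *)
Lemma sqrtD_sqrtB y : 0 < y < 1 ->
  Num.sqrt (1 + Num.sqrt y) - Num.sqrt (1 - Num.sqrt y) =
  Num.sqrt 2 * Num.sqrt y * w_fun y.
Proof.
move=> /andP[y0 y1]; set t := Num.sqrt y.
have t0 : 0 < t by rewrite sqrtr_gt0.
have tt : t ^+ 2 = y by rewrite sqr_sqrtr // ltW.
have t1 : t < 1.
  by rewrite -(@ltr_pXn2r _ 2) ?nnegrE ?ler01 ?(ltW t0) // tt expr1n.
rewrite /w_fun; set s := Num.sqrt (1 - y).
have s0 : 0 <= s by exact: sqrtr_ge0.
have -> : (1 + s) `^ (- 2^-1) = (Num.sqrt (1 + s))^-1.
  by rewrite powRN powR12_sqrt //; lra.
have sE : s = Num.sqrt (1 + t) * Num.sqrt (1 - t).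
  by rewrite -sqrtrM; [congr Num.sqrt; rewrite -tt; ring|lra].
have p1 : Num.sqrt (1 + t) ^+ 2 = 1 + t by rewrite sqr_sqrtr //; lra.
have m1 : Num.sqrt (1 - t) ^+ 2 = 1 - t by rewrite sqr_sqrtr //; lra.
have s2 : s ^+ 2 = 1 - t ^+ 2 by rewrite sqr_sqrtr ?tt //; lra.
have q2 : Num.sqrt (1 + s) ^+ 2 = 1 + s by rewrite sqr_sqrtr //; lra.
have r2 : Num.sqrt 2 ^+ 2 = 2 :> R by rewrite sqr_sqrtr.
have q0 : 0 < Num.sqrt (1 + s) by rewrite sqrtr_gt0; lra.
apply/eqP; rewrite -(@eqrXn2 _ 2) //; last 2 first.
- by rewrite subr_ge0 ler_wsqrtr //; lra.
- by rewrite !mulr_ge0 ?sqrtr_ge0 ?invr_ge0.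
rewrite !exprMn r2 exprVn q2 sqrrB p1 m1 -sE.
have -> : t ^+ 2 = (1 - s) * (1 + s) by rewrite -[LHS](subKr 1) -s2; ring.
by apply/eqP; field; lra.
Qed.

(** In the difference of the series at -t and t the even terms cancel and the odd ones double with a
    minus sign; dividing by sqrt 2 * t leaves the factor -2 / sqrt 2 = - sqrt 2. *)
Definition w_coeff (k : nat) : R := - Num.sqrt 2 * sqrt_coeff k.*2.+1.

Lemma w_coeff_gt0 k : 0 < w_coeff k.
Proof.
by rewrite /w_coeff mulNr oppr_gt0 pmulr_rlt0 ?sqrtr_gt0 // sqrt_coeffS_lt0.
Qed.

Lemma w_coeff_expansion y : 0 < y < 1 -> pseries w_coeff y @ \oo --> w_fun y.
Proof.
move=> y01; have /andP[y0 y1] := y01; pose t := Num.sqrt y.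
have t0 : 0 < t by rewrite sqrtr_gt0.
have tt : t ^+ 2 = y by rewrite sqr_sqrtr // ltW.
have t1 : `|t| < 1.
  rewrite gtr0_norm // -(@ltr_pXn2r _ 2) ?nnegrE ?ler01 ?(ltW t0) //.
  by rewrite tt expr1n.
have r2 : Num.sqrt 2 ^+ 2 = 2 :> R by rewrite sqr_sqrtr.
have r0 : Num.sqrt 2 != 0 :> R by rewrite gt_eqF // sqrtr_gt0.
have t1' : `|- t| < 1 by rewrite normrN.
rewrite (_ : w_fun y = (Num.sqrt 2 * t)^-1 *
   (Num.sqrt (1 - (- t)) - Num.sqrt (1 - t))); last first.
  rewrite opprK sqrtD_sqrtB // -/t; field.
  by rewrite r0 gt_eqF.
rewrite (_ : pseries w_coeff y = cst (Num.sqrt 2 * t)^-1 \*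
  (fun n => pseries sqrt_coeff (- t) (n * 2)%N -
            pseries sqrt_coeff t (n * 2)%N)).
  apply: cvgM; first exact: cvg_cst.
  apply: cvgB.
    exact: (cvg_comp _ _ (@cvg_mulnr 2 isT) (cvg_sqrt_series t1')).
  exact: (cvg_comp _ _ (@cvg_mulnr 2 isT) (cvg_sqrt_series t1)).
apply/funext => n /=; rewrite /pseries /series /=.
(* The n-th partial sum for w matches the partial sums of length 2 n at -t and t: each step adds one
   even term, which cancels, and one odd term. *)
elim: n => [|n IH]; first by rewrite mul0n !big_nil subrr mulr0.
rewrite mulSn !big_nat_recr //= IH -!(mulnC 2) !mul2n.
rewrite -[_ / _ * _]/(sqrt_coeff n.*2.+1) /w_coeff !exprS exprNn -tt.
rewrite -exprM mul2n.
rewrite -signr_odd odd_double expr0 mul1r.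
move: (\sum_(0 <= k < _) _) (\sum_(0 <= k < _) _) => A B.
move: (sqrt_coeff _) (sqrt_coeff _) (t ^+ _) => c d T.
have -> : - Num.sqrt 2 * d * T =
    (Num.sqrt 2 * t)^-1 * (- Num.sqrt 2 ^+ 2 * d * (t * T)).
  by field; rewrite r0 gt_eqF.
by rewrite r2; ring.
Qed.
End SqrtSeries.

(** * Moments of the distributions of w and inversion of the mean *)

Section Moments.
Context {R : realType}.
Implicit Types (a : nat -> R) (x y : R).

Definition psd_mean y : R := (1 - Num.sqrt (1 - y)) / (4 * Num.sqrt (1 - y)).

Lemma w_fun_gt0 y : 0 < w_fun y :> R.
Proof. by rewrite /w_fun powR_gt0 // ltr_wpDr // sqrtr_ge0. Qed.

(** The derivative is written through the mean m, so that y w' is literally m w. Direct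
    differentiation gives w / (4 s (1 + s)) with s = sqrt (1 - y), and y = (1 - s) (1 + s)
    reconciles the two forms. *)
Lemma is_derive_w_fun y : 0 < y < 1 ->
  is_derive y 1 (@w_fun R) (psd_mean y * w_fun y / y).
Proof.
move=> /andP[y0 y1]; have ds := is_derive_sqrt1B y1.
have s0 : 0 < Num.sqrt (1 - y) by rewrite sqrtr_gt0 subr_gt0.
have ss := sqr_sqrtr (ltW (etrans (subr_gt0 y 1) y1)).
have s1_gt0 : 0 < 1 + Num.sqrt (1 - y) by lra.
have ds1 : is_derive y 1 (fun t => 1 + Num.sqrt (1 - t))
    (- (2 * Num.sqrt (1 - y))^-1).
  by have := is_deriveD (is_derive_cst (1 : R) y 1) ds; rewrite add0r.
have dw := is_derive1_comp (f := fun t => t `^ (- 2^-1))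
  (g := fun t => 1 + Num.sqrt (1 - t))
  (is_derive1_powR (- 2^-1) s1_gt0) ds1.
apply: is_derive_eq dw _.
rewrite powRD ?(gt_eqF s1_gt0) ?implybT // powR_inv1 ?(ltW s1_gt0) //.
rewrite -/(w_fun y) /psd_mean.
move: (Num.sqrt _) (w_fun y) s0 s1_gt0 ss => s w s0 s1 ss.
have yE : y = (1 - s) * (1 + s) by rewrite -[LHS](subKr 1) -ss; ring.
have s_lt1 : 0 < 1 - s by rewrite -(pmulr_lgt0 _ s1) -yE.
by rewrite yE; field; rewrite !gt_eqF.
Qed.

Lemma is_derive_psd_mean y : y < 1 ->
  is_derive y 1 psd_mean (8 * Num.sqrt (1 - y) ^+ 3)^-1.
Proof.
move=> y1; have ds := is_derive_sqrt1B y1.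
have s0 : Num.sqrt (1 - y) != 0 by rewrite gt_eqF // sqrtr_gt0 subr_gt0.
have dV := is_deriveV (f := fun t => Num.sqrt (1 - t)) s0 ds.
(* The form (1 / s - 1) / 4 is easier to differentiate. The two forms disagree where the root is 0,
   so the equality is only claimed near y. *)
have s1 : \near y, 4^-1 * (Num.sqrt (1 - y))^-1 - 4^-1 = psd_mean y.
  near=> t; rewrite /psd_mean.
  have st : Num.sqrt (1 - t) != 0.
    rewrite gt_eqF // sqrtr_gt0 subr_gt0; near: t; exact: lt_nbhsl.
  by field; rewrite st.
apply: near_eq_is_derive s1 _; apply: is_derive_eq.
rewrite /GRing.scale /=.
move: (Num.sqrt _) s0 => s s0.
by field.
Unshelve. all: by end_near. Qed.

Lemma psd_first_moment a y : nonneg_expansion (@w_fun R) 1 a -> 0 < y < 1 ->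
  pseries (fun k => k%:R * a k) y @ \oo --> psd_mean y * w_fun y.
Proof.
move=> [_ aw] y01.
rewrite [X in _ --> X](_ : _ = y * (psd_mean y * w_fun y / y)).
  exact: pseries_euler aw y01 (is_derive_w_fun y01).
by have /andP[y0 _] := y01; field; rewrite gt_eqF.
Qed.

(** Applying y * d/dy once more, to m w, gives y m' w + m (y w') = (y m' + m ^ 2) w. *)
Lemma psd_second_moment a y : nonneg_expansion (@w_fun R) 1 a -> 0 < y < 1 ->
  pseries (fun k => k%:R * (k%:R * a k)) y @ \oo -->
  (y / (8 * Num.sqrt (1 - y) ^+ 3) + psd_mean y ^+ 2) * w_fun y.
Proof.
move=> aw y01; have /andP[y0 y1] := y01.
have dm := is_derive_psd_mean y1; have dw := is_derive_w_fun y01.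
have h := pseries_euler (fun t => @psd_first_moment a t aw) y01
  (is_deriveM dm dw).
rewrite [X in _ --> X](_ : _ = y * (psd_mean y * (psd_mean y * w_fun y / y) +
  w_fun y * (8 * Num.sqrt (1 - y) ^+ 3)^-1)) //.
have s0 : Num.sqrt (1 - y) != 0 by rewrite gt_eqF // sqrtr_gt0 subr_gt0.
move: (psd_mean y) (w_fun y) (Num.sqrt _) s0 => m w s s0.
by field; rewrite s0 gt_eqF.
Qed.

Lemma psd_expectation a y (P : probability nat R) :
  nonneg_expansion (@w_fun R) 1 a -> 0 < y < 1 -> is_psd (@w_fun R) a y P ->
  'E_P[@nat_value R]%E = (psd_mean y)%:E.
Proof.
move=> aw y01 Pa; have w0 : w_fun y != 0 :> R by rewrite gt_eqF // w_fun_gt0.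
rewrite unlock; apply: integral_law_nat Pa _ _ => [k|]; first exact: ler0n.
rewrite -(mulfK w0 (psd_mean y)).
rewrite (_ : series _ = pseries (fun k => k%:R * a k) y \* cst (w_fun y)^-1).
  by apply: cvgM; [exact: psd_first_moment|exact: cvg_cst].
apply/funext => n; rewrite /pseries /series /= mulr_suml.
by apply: eq_bigr => k _; rewrite /nat_value !mulrA.
Qed.

Lemma psd_variance a y (P : probability nat R) :
  nonneg_expansion (@w_fun R) 1 a -> 0 < y < 1 -> is_psd (@w_fun R) a y P ->
  'V_P[@nat_value R]%E = (y / (8 * Num.sqrt (1 - y) ^+ 3))%:E.
Proof.
move=> aw y01 Pa; have w0 : w_fun y != 0 :> R by rewrite gt_eqF // w_fun_gt0.
rewrite /variance unlock (psd_expectation aw y01 Pa) unlock /=.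
apply: integral_law_nat Pa _ _ => [k|]; first by rewrite -expr2 sqr_ge0.
have E0 := aw.2 y y01; have E1 := psd_first_moment aw y01.
have E2 := psd_second_moment aw y01.
set v := y / _ in E2 *.
set m := psd_mean y in E1 E2 *.
set w := w_fun y in w0 E0 E1 E2 *.
(* Expanding (k - m) ^ 2 splits the variance series into the second moment, -2 m times the first
   moment and m ^ 2 times the total mass, each with its limit already known. *)
rewrite (_ : v = ((v + m ^+ 2) * w - 2 * m * (m * w) + m ^+ 2 * w) * w^-1);
  last first.
  by field.
rewrite (_ : series _ = (pseries (fun k => k%:R * (k%:R * a k)) y
    - cst (2 * m) \* pseries (fun k => k%:R * a k) y
    + cst (m ^+ 2) \* pseries a y) \* cst w^-1).
  apply: cvgM; last exact: cvg_cst.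
  apply: cvgD; last by apply: cvgM => //; exact: cvg_cst.
  by apply: cvgB => //; apply: cvgM => //; exact: cvg_cst.
apply/funext => n; rewrite !fctE /pseries /series /= !mulr_sumr.
rewrite -sumrN -!big_split /= mulr_suml.
by apply: eq_bigr => k _; rewrite ?fctE /nat_value /=; ring.
Qed.

Lemma psd_exists a y : nonneg_expansion (@w_fun R) 1 a -> 0 < y < 1 ->
  exists P : probability nat R, is_psd (@w_fun R) a y P.
Proof.
move=> [a0 aw] y01; have w0 := w_fun_gt0 y; have /andP[y0 _] := y01.
apply: law_nat_exists.
  by move=> k; rewrite divr_ge0 ?(ltW w0) // mulr_ge0 // exprn_ge0 // ltW.
rewrite -(divff (lt0r_neq0 w0)).
rewrite (_ : series _ = pseries a y \* cst (w_fun y)^-1).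
  by apply: cvgM; [exact: aw|exact: cvg_cst].
by apply/funext => n; rewrite /pseries /series /= mulr_suml.
Qed.

(** The inverse of [psd_mean]: solve x = (1 / s - 1) / 4 for s and take y = 1 - s ^ 2. *)
Definition psd_param x : R := 1 - ((1 + 4 * x) ^+ 2)^-1.

Lemma sqrt1B_psd_param x : 0 < x ->
  Num.sqrt (1 - psd_param x) = (1 + 4 * x)^-1.
Proof.
move=> x0; rewrite /psd_param subKr -exprVn sqrtr_sqr ger0_norm //.
by rewrite invr_ge0; lra.
Qed.

Lemma psd_param_itv x : 0 < x -> 0 < psd_param x < 1.
Proof.
move=> x0; have d1 : 1 < (1 + 4 * x) ^+ 2 by rewrite exprn_egt1 //; lra.
by rewrite subr_gt0 invf_lt1 ?gtrBl ?invr_gt0 ?d1 //=; lra.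
Qed.

Lemma psd_paramK x : 0 < x -> psd_mean (psd_param x) = x.
Proof. by move=> x0; rewrite /psd_mean sqrt1B_psd_param //; field; lra. Qed.

Lemma psd_meanK y : 0 < y < 1 -> psd_param (psd_mean y) = y.
Proof.
move=> /andP[y0 y1].
have s0 : 0 < Num.sqrt (1 - y) by rewrite sqrtr_gt0 subr_gt0.
have ss := sqr_sqrtr (ltW (etrans (subr_gt0 y 1) y1)).
rewrite /psd_param /psd_mean.
have -> : 1 + 4 * ((1 - Num.sqrt (1 - y)) / (4 * Num.sqrt (1 - y))) =
    (Num.sqrt (1 - y))^-1 by field; rewrite gt_eqF.
by rewrite exprVn invrK ss subKr.
Qed.

Lemma psd_mean_gt0 y : 0 < y < 1 -> 0 < psd_mean y.
Proof.
move=> /andP[y0 y1].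
have s0 : 0 < Num.sqrt (1 - y) by rewrite sqrtr_gt0 subr_gt0.
rewrite divr_gt0 ?mulr_gt0 // subr_gt0 -[ltRHS]sqrtr1 ltr_sqrt //; lra.
Qed.

Lemma psd_param_homo x x' : 0 < x -> x < x' -> psd_param x < psd_param x'.
Proof.
move=> x0 xx'; rewrite ltrD2l ltrN2 ltf_pV2 ?posrE ?exprn_gt0; try lra.
by rewrite ltrXn2r ?nnegrE //; lra.
Qed.

Lemma is_derive_psd_param x : 0 < x ->
  is_derive x 1 psd_param (8 / (1 + 4 * x) ^+ 3).
Proof.
move=> x0; have p0 : 1 + 4 * x != 0 by lra.
have q0 : (fun t => (1 + 4 * t) ^+ 2) x != 0 by rewrite expf_eq0.
have dq : is_derive x 1 (fun t => (1 + 4 * t) ^+ 2) (8 * (1 + 4 * x)).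
  apply: is_derive_eq; rewrite /GRing.scale /=.
  by ring.
have dV := is_deriveV (f := fun t => (1 + 4 * t) ^+ 2) q0 dq.
apply: is_derive_eq; rewrite /GRing.scale /=.
by field.
Qed.
End Moments.

Theorem mainTheorem3 (R : realType) :
  (exists2 a : nat -> R,
     forall k, 0 < a k & nonneg_expansion (@w_fun R) 1 a) /\
  (forall a : nat -> R, nonneg_expansion (@w_fun R) 1 a ->
     is_variance_function (@w_fun R) 1 a [set x : R | 0 < x]
       (fun x => x * (2 * x + 1) * (4 * x + 1))).
Proof.
split.
  exists w_coeff; first exact: w_coeff_gt0.
  by split=> [k|]; [exact: ltW (w_coeff_gt0 k)|exact: w_coeff_expansion].
(* The mean and the variance are determined by w alone, so the same inverse serves every expansion
   [a]. *)
move=> a aw; exists psd_param; first split.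
- split=> [x /= x0|x x'|y /= y01]; first exact: psd_param_itv.
    rewrite !inE /= => x0 x'0 xx'.
    by rewrite -(psd_paramK x0) xx' psd_paramK.
  by exists (psd_mean y); [exact: psd_mean_gt0|exact: psd_meanK].
- by move=> s t /= s0 _; exact: psd_param_homo.
- move=> x /= x0; have y01 := psd_param_itv x0.
  have [P Pa] := psd_exists aw y01; exists P => //.
  by rewrite (psd_expectation aw y01 Pa) psd_paramK.
move=> x /= x0; have dy := is_derive_psd_param x0.
have dyE : derive1 psd_param x = 8 / (1 + 4 * x) ^+ 3.
  by rewrite derive1E derive_val.
have p0 : 1 + 4 * x != 0 by lra.
split.
- move=> P Pa; rewrite (psd_variance aw (psd_param_itv x0) Pa).
  (* With s = 1 / (1 + 4 x), the value y / (8 s ^ 3) is (1 + 4 x) ((1 + 4 x) ^ 2 - 1) / 8, which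
     factors as claimed; the quotient y / y' below is the same expression. *)
  by rewrite sqrt1B_psd_param // /psd_param; congr EFin; field.
- by have [] := dy.
- by rewrite dyE mulf_neq0 ?invr_neq0 ?expf_neq0 // pnatr_eq0.
- by rewrite dyE /psd_param; field.
Qed.
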